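(* Let $N\in\mathfrak{u}(n)$ be a fixed skew-Hermitian matrix, let $L_0\in\mathfrak{u}(n)$, and let $\mathcal{O}$ be the adjoint orbit of $\operatorname{U}(n)$ containing $L_0$. Let $H(L)=\kappa(L,N)=\operatorname{Trace}(LN)$. Then the flow $$\dot L=[L,[L,N]],\qquad L(0)=L_0,$$ is the flow of the gradient vector field of $H$ on $\mathcal{O}$ with respect to the normal metric $\langle\cdot,\cdot\rangle_n$; that is, for every $L\in\mathcal{O}$, the gradient of $H|_{\mathcal{O}}$ at $L$ with respect to $\langle\cdot,\cdot\rangle_n$ is $\operatorname{grad}H(L)=[L,[L,N]]$.
   Context: $\mathfrak{g}=\mathfrak{u}(n)$ is the Lie algebra of skew-Hermitian $n\times n$ complex matrices, with $[A,B]=AB-BA$. Let $\kappa(A,B):=\operatorname{Trace}(AB)$ on $\mathfrak{u}(n)$, and $\langle A,B\rangle:=-\kappa(A,B)$, which is an inner product. The adjoint orbit of $\operatorname{U}(n)$ through $L_0$ is $\{\Theta L_0\Theta^{-1}\mid\Theta\in\operatorname{U}(n)\}$; its tangent space at $L$ is $\{[L,X]\mid X\in\mathfrak{g}\}$. For $L\in\mathfrak{g}$ there is a $\langle\cdot,\cdot\rangle$-orthogonal decomposition $\mathfrak{g}=\mathfrak{g}^L\oplus\mathfrak{g}_L$, where $\mathfrak{g}_L$ is the centralizer of $L$ in $\mathfrak{g}$ and $\mathfrak{g}^L=\operatorname{Im}\operatorname{ad}_L$, $\operatorname{ad}_L=[L,\cdot]$. For $X\in\mathfrak{g}$, $X^L$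 denotes the orthogonal projection of $X$ onto $\mathfrak{g}^L$. The normal metric on the adjoint orbit is the Riemannian metric defined at $L$ by $\langle[L,X],[L,Y]\rangle_n:=\langle X^L,Y^L\rangle$ for $X,Y\in\mathfrak{g}$. The gradient is defined by $dH(L)\cdot[L,X]=\langle\operatorname{grad}H(L),[L,X]\rangle_n$ for all $X\in\mathfrak{g}$. *)

(* Defs.v *)
From mathcomp Require Import all_boot all_order all_algebra.
From mathcomp Require Import complex spectral.
From mathcomp Require Import all_classical all_reals all_analysis.
Set Implicit Arguments.
Unset Strict Implicit.
Unset Printing Implicit Defensive.
Import Order.TTheory GRing.Theory Num.Theory.
Import numFieldNormedType.Exports.
Local Open Scope classical_set_scope.
Local Open Scope ring_scope.
Local Open Scope sesquilinear_scope.
Local Open Scope complex_scope.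

Definition lie_un (R : realType) (n : nat) : set 'M[R[i]]_n :=
  [set A | A ^t* = - A].

Definition lie (R : realType) (n : nat) (A B : 'M[R[i]]_n) : 'M[R[i]]_n :=
  A *m B - B *m A.

(* The trace of the product of two skew-Hermitian matrices is real
   (kappaE below), so taking the real part loses nothing on u(n). *)
Definition kappa (R : realType) (n : nat) (A B : 'M[R[i]]_n) : R :=
  complex.Re (\tr (A *m B)).

Definition inner (R : realType) (n : nat) (A B : 'M[R[i]]_n) : R :=
  - kappa A B.

Definition adjoint_orbit (R : realType) (n : nat) (L0 : 'M[R[i]]_n) :
    set 'M[R[i]]_n :=
  [set Theta *m L0 *m invmx Theta | Theta in [set T | T \is unitarymx]].

(* Im ad_L, written g^L in the decomposition g = g^L + g_L; this is also the
   tangent space at L of the adjoint orbit through L. *)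
Definition im_ad (R : realType) (n : nat) (L : 'M[R[i]]_n) :
    set 'M[R[i]]_n :=
  [set lie L X | X in @lie_un R n].

Definition is_proj_ad (R : realType) (n : nat) (L X P : 'M[R[i]]_n) : Prop :=
  im_ad L P /\ (forall Z, im_ad L Z -> inner (X - P) Z = 0).

Definition proj_ad (R : realType) (n : nat) (L X : 'M[R[i]]_n) :
    'M[R[i]]_n :=
  xget 0 [set P | is_proj_ad L X P].

Definition ad_preimage (R : realType) (n : nat) (L V : 'M[R[i]]_n) :
    'M[R[i]]_n :=
  xget 0 [set X | lie_un X /\ lie L X = V].

(* The value does not depend on the chosen preimages: see normal_metricE. *)
Definition normal_metric (R : realType) (n : nat) (L V W : 'M[R[i]]_n) : R :=
  inner (proj_ad L (ad_preimage L V)) (proj_ad L (ad_preimage L W)).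

(* Derivative of a curve of complex matrices with respect to a real parameter,
   through the 2 n^2 real coordinates. *)
Definition has_velocity (R : realType) (n : nat) (g : R -> 'M[R[i]]_n)
    (t : R) (V : 'M[R[i]]_n) : Prop :=
  forall i j : 'I_n,
    is_derive t (1 : R) (fun s => complex.Re (g s i j)) (complex.Re (V i j)) /\
    is_derive t (1 : R) (fun s => complex.Im (g s i j)) (complex.Im (V i j)).

Definition curve_through (R : realType) (n : nat) (O : set 'M[R[i]]_n)
    (L V : 'M[R[i]]_n) (g : R -> 'M[R[i]]_n) : Prop :=
  [/\ g 0 = L, (\forall t \near (0 : R), O (g t)) & has_velocity g 0 V].

(* d is the value at the tangent vector V of the differential at L of the
   restriction of H to O. *)
Definition is_differential (R : realType) (n : nat) (O : set 'M[R[i]]_n)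
    (H : 'M[R[i]]_n -> R) (L V : 'M[R[i]]_n) (d : R) : Prop :=
  (exists g, curve_through O L V g) /\
  (forall g, curve_through O L V g ->
     is_derive (0 : R) (1 : R) (fun t => H (g t)) d).

Definition is_gradient (R : realType) (n : nat) (O : set 'M[R[i]]_n)
    (H : 'M[R[i]]_n -> R) (L G : 'M[R[i]]_n) : Prop :=
  im_ad L G /\
  (forall X, lie_un X ->
     is_differential O H L (lie L X) (normal_metric L G (lie L X))).

Lemma kappaE (R : realType) (n : nat) (A B : 'M[R[i]]_n) :
  lie_un A -> lie_un B -> (kappa A B)%:C = \tr (A *m B).
Proof.
move=> hA hB; rewrite /kappa; apply/eqP.
suff: (\tr (A *m B))^* = \tr (A *m B).
  case: (\tr _) => a b [] /eqP; rewrite eq_sym -addr_eq0 -mulr2n mulrn_eq0 /=.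
  by move=> /eqP ->.
have -> : (\tr (A *m B))^* = \tr ((A *m B) ^t*).
  rewrite /mxtrace (rmorph_sum (@conjc R)); apply: eq_bigr => k _.
  by rewrite [RHS]mxE [in RHS]mxE.
by rewrite trmx_mul map_mxM hA hB mulNmx mulmxN opprK mxtrace_mulC.
Qed.

Lemma normal_metricE (R : realType) (n : nat) (L X Y : 'M[R[i]]_n) :
  lie_un L -> lie_un X -> lie_un Y ->
  normal_metric L (lie L X) (lie L Y) = inner (proj_ad L X) (proj_ad L Y).
Proof.
move=> _.
suff P Z : lie_un Z -> proj_ad L (ad_preimage L (lie L Z)) = proj_ad L Z.
  by move=> hX hY; rewrite /normal_metric !P.
move=> hZ; rewrite /ad_preimage; case: xgetP => [W _ [hW eW]|/(_ Z)]; last first.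
  by case; split.
have innerB A B C : @inner R n (A - B) C = inner A C - inner B C.
  rewrite /inner /kappa mulmxBl raddfB /=.
  by case: (\tr _) (\tr _) => a b [c d] /=; rewrite opprB opprK addrC.
have WZ C : im_ad L C -> inner W C = inner Z C.
  move=> [D hD <-]; apply/eqP; rewrite -subr_eq0 -innerB.
  have c : (W - Z) *m L = L *m (W - Z).
    apply/eqP; rewrite eq_sym -subr_eq0; apply/eqP.
    move: eW; rewrite /lie => /eqP; rewrite -subr_eq0 => /eqP <-.
    by rewrite mulmxBr mulmxBl !opprD !opprK addrACA.
  rewrite /inner /kappa /lie mulmxBr mulmxA c [\tr _]raddfB /=.
  by rewrite (mulmxA (W - Z)) (mxtrace_mulC _ L) mulmxA subrr oppr0.
rewrite /proj_ad; congr xget; apply/seteqP; split=> P [hP oP]; split=> // C hC.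
- by rewrite innerB -WZ // -innerB oP.
- by rewrite innerB WZ // -innerB oP.
Qed.

(* Main.v *)
Require Import Defs.
From mathcomp Require Import all_boot all_order all_fingroup all_algebra.
From mathcomp Require Import complex spectral.
From mathcomp Require Import ring.
From mathcomp Require Import all_classical all_reals all_analysis.

(** Gradient.  Both halves of the gradient formula come from the invariance of
the trace form, [kappa_lie].  It says that ad_L is skew for the inner product,
so u(n) splits orthogonally as Im ad_L plus the centralizer of L; here the
splitting is made explicit by diagonalizing L and dividing entries by
eigenvalue differences ([centralizer_decomposition]).  Hence projections onto
Im ad_L exist and the normal metric of [L,X] and [L,Y] is the inner product of
the projection of X with Y.  As [L,N] already lies in Im ad_L,
  <[L,[L,N]], [L,X]>_n = - Tr([L,N] X) = Tr([L,X] N),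
and the right-hand side is dH(L).[L,X] since H is linear.  The differential is
taken along curves in the orbit, so each tangent vector [L,X] has to be realized
by a curve: conjugation by a one-parameter unitary group with generator X does
this ([unitary_curve]).  The gradient is unique because the normal metric is
nondegenerate ([normal_metric_nondegenerate]).

Flow.  By the gradient formula, the two descriptions of the flow differ only in
that one asks the solution to be skew-Hermitian and the other asks it to stay on
the orbit of L_0.  One direction holds because the orbit consists of
skew-Hermitian matrices.  For the other, the equation is a Lax equation
L' = [L,B], so every Tr(L^k) is constant in time.  Power sums determine a
multiset of complex numbers ([eq_power_sums_perm]), so the eigenvalues are
constant with multiplicities, and two skew-Hermitian matrices with the same
eigenvalues are unitarily conjugate ([isospectral_adjoint_orbit]). *)

Set Implicit Arguments.
Unset Strict Implicit.
Unset Printing Implicit Defensive.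
Import Order.TTheory GRing.Theory Num.Theory.
Import numFieldNormedType.Exports.
Local Open Scope classical_set_scope.
Local Open Scope ring_scope.
Local Open Scope sesquilinear_scope.

(** * Skew-Hermitian matrices and the normal metric *)

Section SkewHermitian.
Variables (R : realType) (n : nat).
Implicit Types A B C D L X P : 'M[R[i]]_n.

Lemma adjmxM A B : (A *m B) ^t* = B ^t* *m A ^t*.
Proof. by rewrite trmx_mul map_mxM. Qed.

Lemma adjmxB A B : (A - B) ^t* = A ^t* - B ^t*.
Proof. by apply/matrixP => i j; rewrite !mxE rmorphB. Qed.

Lemma lieBr A B C : lie A (B - C) = lie A B - lie A C.
Proof.
rewrite /lie mulmxBr mulmxBl !opprB addrACA [RHS]addrACA.
by congr (_ + _); rewrite addrC.
Qed.

Lemma lie_unB A B : lie_un A -> lie_un B -> lie_un (A - B).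
Proof. by rewrite /lie_un /= => hA hB; rewrite adjmxB hA hB opprB opprK addrC. Qed.

Lemma lie_un_lie A B : lie_un A -> lie_un B -> lie_un (lie A B).
Proof.
rewrite /lie_un /= => hA hB.
by rewrite /lie adjmxB !adjmxM hA hB !mulmxN !mulNmx !opprK opprB.
Qed.

Lemma lie_un_conj P A : lie_un A -> lie_un (P *m A *m P ^t*).
Proof.
by rewrite /lie_un /= => hA; rewrite !adjmxM trmxCK hA mulNmx mulmxN mulmxA.
Qed.

Lemma adjoint_orbit_lie_un L A : lie_un L -> adjoint_orbit L A -> lie_un A.
Proof.
by move=> hL [T /= hT <-]; rewrite invmx_unitary //; apply: lie_un_conj.
Qed.

Lemma kappaC A B : kappa A B = kappa B A.
Proof. by rewrite /kappa mxtrace_mulC. Qed.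

Lemma kappaBl A B C : kappa (A - B) C = kappa A C - kappa B C.
Proof.
rewrite /kappa mulmxBl raddfB /=.
by case: (\tr _) (\tr _) => a b [c d].
Qed.

(** Cyclicity of the trace; this is the invariance of the trace form under the
adjoint action. *)
Lemma kappa_lie A B C : kappa (lie A B) C = kappa A (lie B C).
Proof.
rewrite /kappa /lie mulmxBl mulmxBr !raddfB /= !mulmxA.
by rewrite (mxtrace_mulC (B *m A)) (mulmxA C) (mxtrace_mulC (C *m B)) mulmxA.
Qed.

Lemma innerBl A B C : inner (A - B) C = inner A C - inner B C.
Proof. by rewrite /inner kappaBl opprB opprK addrC. Qed.

(** For skew-Hermitian A, the inner product of A with itself is Tr(A A^H), the
sum of the squared moduli of the entries. *)
Lemma inner_eq0 A : lie_un A -> inner A A = 0 -> A = 0.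
Proof.
move=> hA h.
have : \tr (A *m A ^t*) = 0.
  move: (kappaE hA hA); rewrite hA mulmxN raddfN /= => <-.
  by move/eqP: h; rewrite oppr_eq0 => /eqP ->; rewrite oppr0.
rewrite /mxtrace => /eqP; rewrite psumr_eq0; last first.
  by move=> i _; rewrite mxE sumr_ge0 // => j _; rewrite !mxE mul_conjC_ge0.
move=> /allP h0; apply/matrixP => i j; rewrite mxE.
move: (h0 i (mem_index_enum _)) => /=; rewrite mxE psumr_eq0; last first.
  by move=> k _; rewrite !mxE mul_conjC_ge0.
move=> /allP /(_ j (mem_index_enum _)) /=.
by rewrite !mxE mul_conjC_eq0 => /eqP.
Qed.

(** The easy half of the orthogonality between the centralizer and the image of
ad_L; it is an instance of invariance. *)
Lemma inner_lie0 L C X : lie C L = 0 -> inner C (lie L X) = 0.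
Proof.
by move=> h; rewrite /inner -kappa_lie h /kappa mul0mx mxtrace0 oppr0.
Qed.

(** A skew-Hermitian matrix is normal, so the spectral theorem applies; its
eigenvalues are purely imaginary because conjugation by a unitary matrix
preserves u(n). *)
Lemma skew_spectral L : lie_un L -> exists P d,
  [/\ P \is unitarymx, L = P ^t* *m diag_mx d *m P &
      forall i, (d 0 i)^* = - d 0 i].
Proof.
move=> hL; have : L \is normalmx.
  by apply/normalmxP; rewrite hL mulmxN mulNmx.
move=> /orthomx_spectralP; set P := spectralmx L; set d := spectral_diag L => eL.
have uP : P \is unitarymx by exact: spectral_unitarymx.
rewrite invmx_unitary // in eL; exists P, d; split=> // i.
have eD : diag_mx d = P *m L *m P ^t*.
  by rewrite eL !mulmxA (unitarymxP uP) mul1mx -mulmxA (unitarymxP uP) mulmx1.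
have : lie_un (diag_mx d) by rewrite eD; apply: lie_un_conj.
by move=> /matrixP /(_ i i); rewrite !mxE eqxx mulr1n.
Qed.

Lemma conj_unitaryK P A : P \is unitarymx -> P ^t* *m (P *m A *m P ^t*) *m P = A.
Proof.
move=> uP; have e : P ^t* *m P = 1%:M.
  by rewrite -invmx_unitary // mulVmx // unitarymx_unit.
by rewrite !mulmxA e mul1mx -mulmxA e mulmx1.
Qed.

Lemma lie_conj P A B : P \is unitarymx ->
  lie (P ^t* *m A *m P) (P ^t* *m B *m P) = P ^t* *m lie A B *m P.
Proof.
move=> uP.
have conjM C D : P ^t* *m C *m P *m (P ^t* *m D *m P) = P ^t* *m (C *m D) *m P.
  by rewrite !mulmxA (mulmxtVK _ uP).
by rewrite /lie !conjM mulmxBr mulmxBl.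
Qed.

(** In an eigenbasis of L, ad_L multiplies the entry (i, j) by d_i - d_j.  So W is
obtained by dividing by d_i - d_j, and what remains of X are the entries with
d_i = d_j, which form a matrix that commutes with L. *)
Lemma centralizer_decomposition L X : lie_un L -> lie_un X ->
  exists2 W, lie_un W & lie (X - lie L W) L = 0.
Proof.
move=> hL hX; have [P [d [uP eL hd]]] := skew_spectral hL.
have [Y hY eX] : exists2 Y, lie_un Y & X = P ^t* *m Y *m P.
  by exists (P *m X *m P ^t*); [exact: lie_un_conj|rewrite conj_unitaryK].
(* When d_i = d_j the quotient is 0, by the convention 0^-1 = 0. *)
pose W := \matrix_(i, j) (Y i j / (d 0 i - d 0 j)).
have hW : lie_un W.
  (* Conjugation together with the exchange of i and j changes the sign of the
     numerator and preserves the denominator. *)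
  apply/matrixP => i j; rewrite !mxE rmorphM fmorphV rmorphB /= !hd.
  have -> : (Y j i)^* = - Y i j by move/matrixP: hY => /(_ i j); rewrite !mxE.
  by rewrite mulNr opprK addrC.
exists (P ^t* *m W *m P).
  by have := lie_un_conj (P ^t*) hW; rewrite trmxCK.
rewrite {1}eX {1}eL lie_conj // -mulmxBl -mulmxBr eL lie_conj //.
suff -> : lie (Y - lie (diag_mx d) W) (diag_mx d) = 0 by rewrite mulmx0 mul0mx.
apply/matrixP => i j; rewrite /lie mul_mx_diag !mul_diag_mx mul_mx_diag !mxE.
have [->|ne] := eqVneq (d 0 i) (d 0 j); first by rewrite [X in _ - X]mulrC subrr.
have -> : d 0 i * (Y i j / (d 0 i - d 0 j)) - Y i j / (d 0 i - d 0 j) * d 0 j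
   = Y i j.
  by rewrite [X in _ - X]mulrC -mulrBl mulrC divfK // subr_eq0.
by rewrite subrr mul0r mulr0 subrr.
Qed.

(** The difference of two projections lies in Im ad_L and is orthogonal to it,
hence is orthogonal to itself. *)
Lemma proj_ad_eq L X P :
  lie_un L -> is_proj_ad L X P -> proj_ad L X = P.
Proof.
move=> hL [[U hU eU] oP]; rewrite /proj_ad; case: xgetP => [Q _|/(_ P)]; last first.
  by case; split => //; exists U.
move=> [[V hV eV] oQ]; apply/eqP; rewrite -subr_eq0; apply/eqP; apply: inner_eq0.
  by rewrite -eU -eV -lieBr; apply/lie_un_lie/lie_unB.
have hZ : im_ad L (Q - P).
  by exists (V - U); [exact: lie_unB|rewrite lieBr eU eV].
have eQ : Q - P = (X - P) - (X - Q) by rewrite opprB [RHS]addrC addrA subrK.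
by rewrite {1}eQ innerBl (oP _ hZ) (oQ _ hZ) subrr.
Qed.

Lemma proj_adP L X : lie_un L -> lie_un X ->
  exists2 W, lie_un W & proj_ad L X = lie L W /\ lie (X - lie L W) L = 0.
Proof.
move=> hL hX; have [W hW cW] := centralizer_decomposition hL hX.
exists W => //; split=> //; apply: proj_ad_eq => //; split; first by exists W.
by move=> _ [Z hZ <-]; apply: inner_lie0.
Qed.

(** Only one of the two arguments needs to be projected, since the other then
contributes its component in Im ad_L alone. *)
Lemma normal_metric_proj L X Y : lie_un L -> lie_un X -> lie_un Y ->
  normal_metric L (lie L X) (lie L Y) = inner (proj_ad L X) Y.
Proof.
move=> hL hX hY; rewrite normal_metricE //.
have [W hW [-> _]] := proj_adP hL hX; have [Z hZ [-> cZ]] := proj_adP hL hY.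
have innerC A B : inner A B = inner B A by rewrite /inner kappaC.
rewrite !(innerC (lie L W)); apply/eqP; rewrite eq_sym -subr_eq0 -innerBl.
by rewrite inner_lie0.
Qed.

(** The identity that makes the double bracket the gradient of L |-> Tr(LN):
[L,N] is its own projection onto Im ad_L, and invariance of the trace form moves
the bracket from N to X. *)
Lemma normal_metric_double_bracket L N X : lie_un L -> lie_un N -> lie_un X ->
  normal_metric L (lie L (lie L N)) (lie L X) = kappa (lie L X) N.
Proof.
move=> hL hN hX; rewrite normal_metric_proj //; last exact: lie_un_lie.
rewrite (@proj_ad_eq L _ (lie L N)) //; last first.
  split; first by exists N.
  by move=> Z _; rewrite subrr /inner /kappa mul0mx mxtrace0 oppr0.
rewrite /inner kappaC -kappa_lie /lie -opprB /kappa mulNmx raddfN /=.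
by case: (\tr _) => a b /=; rewrite opprK.
Qed.

(** Uniqueness of the gradient.  Testing against the difference of the
projections of X and Y shows that these coincide; X and Y then differ by an
element of the centralizer of L, which ad_L kills. *)
Lemma normal_metric_nondegenerate L X Y : lie_un L -> lie_un X -> lie_un Y ->
  (forall Z, lie_un Z ->
     normal_metric L (lie L X) (lie L Z) = normal_metric L (lie L Y) (lie L Z)) ->
  lie L X = lie L Y.
Proof.
move=> hL hX hY h.
have [U hU [pU cU]] := proj_adP hL hX; have [V hV [pV cV]] := proj_adP hL hY.
have e : lie L U = lie L V.
  have hD : lie_un (lie L U - lie L V) by apply: lie_unB; apply: lie_un_lie.
  apply/eqP; rewrite -subr_eq0; apply/eqP; apply: inner_eq0 => //.
  have := h _ hD.
  rewrite (normal_metric_proj hL hX hD) (normal_metric_proj hL hY hD) pU pV => eUV.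
  by rewrite innerBl eUV subrr.
have lieC A B : lie A B = 0 -> lie B A = 0
  by move=> hAB; rewrite /lie -opprB -/(lie A B) hAB oppr0.
apply/eqP; rewrite -subr_eq0 -lieBr.
have -> : X - Y = (X - lie L U) - (Y - lie L V) by rewrite e (opprB Y) addrA subrK.
by rewrite lieBr (lieC _ _ cU) (lieC _ _ cV) subrr.
Qed.

End SkewHermitian.

(** * Velocities of matrix curves *)

Section Velocity.
Variable R : realType.

Lemma ReD (x y : R[i]) : complex.Re (x + y) = complex.Re x + complex.Re y.
Proof. by case: x y => a b []. Qed.

Lemma ImD (x y : R[i]) : complex.Im (x + y) = complex.Im x + complex.Im y.
Proof. by case: x y => a b []. Qed.

(** The scalar analogue of [has_velocity], in the same real coordinates, so that a
velocity is a [cderiv] of each entry. *)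
Definition cderiv (f : R -> R[i]) (t : R) (v : R[i]) : Prop :=
  is_derive t (1 : R) (fun s => complex.Re (f s)) (complex.Re v) /\
  is_derive t (1 : R) (fun s => complex.Im (f s)) (complex.Im v).

Lemma cderiv_cst (c : R[i]) t : cderiv (fun=> c) t 0.
Proof. by split; exact: is_derive_cst. Qed.

Lemma cderiv_ext f g t v : f =1 g -> cderiv f t v -> cderiv g t v.
Proof. by move=> /funext ->. Qed.

Lemma cderivD f g t v w :
  cderiv f t v -> cderiv g t w -> cderiv (fun s => f s + g s) t (v + w).
Proof.
move=> [fr fi] [gr gi]; split.
  have := is_deriveD fr gr; set F := (X in is_derive _ _ X _) => H.
  have -> : (fun s => complex.Re (f s + g s)) = F by apply/funext => s; exact: ReD.
  by apply: is_derive_eq H _; rewrite ReD.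
have := is_deriveD fi gi; set F := (X in is_derive _ _ X _) => H.
have -> : (fun s => complex.Im (f s + g s)) = F by apply/funext => s; exact: ImD.
by apply: is_derive_eq H _; rewrite ImD.
Qed.

Lemma ReM (x y : R[i]) : complex.Re (x * y) =
  complex.Re x * complex.Re y - complex.Im x * complex.Im y.
Proof. by case: x y => a b []. Qed.

Lemma ImM (x y : R[i]) : complex.Im (x * y) =
  complex.Re x * complex.Im y + complex.Im x * complex.Re y.
Proof. by case: x y => a b [c d] /=; rewrite addrC. Qed.

Lemma cderivM f g t v w : cderiv f t v -> cderiv g t w ->
  cderiv (fun s => f s * g s) t (v * g t + f t * w).
Proof.
move=> [fr fi] [gr gi]; split.
  have := is_deriveB (is_deriveM fr gr) (is_deriveM fi gi).
  set F := (X in is_derive _ _ X _) => H.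
  have -> : (fun s => complex.Re (f s * g s)) = F by apply/funext => s; exact: ReM.
  by apply: is_derive_eq H _; rewrite ReD !ReM /GRing.scale /=; ring.
have := is_deriveD (is_deriveM fr gi) (is_deriveM fi gr).
set F := (X in is_derive _ _ X _) => H.
have -> : (fun s => complex.Im (f s * g s)) = F by apply/funext => s; exact: ImM.
by apply: is_derive_eq H _; rewrite ImD !ImM /GRing.scale /=; ring.
Qed.

Lemma cderiv_sum (I : Type) (r : seq I) (F : I -> R -> R[i]) t v :
  (forall i, cderiv (F i) t (v i)) ->
  cderiv (fun s => \sum_(i <- r) F i s) t (\sum_(i <- r) v i).
Proof.
move=> h; elim: r => [|i r IH].
  rewrite big_nil; apply: cderiv_ext (cderiv_cst 0 t) => s.
  by rewrite big_nil.
rewrite big_cons; apply: cderiv_ext (cderivD (h i) IH) => s.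
by rewrite big_cons.
Qed.

Section Matrix.
Variable n : nat.
Implicit Types g h : R -> 'M[R[i]]_n.

Lemma has_velocity_cst (A : 'M[R[i]]_n) t : has_velocity (fun=> A) t 0.
Proof. by move=> i j; rewrite mxE; apply: cderiv_cst. Qed.

Lemma has_velocityM g h t V W : has_velocity g t V -> has_velocity h t W ->
  has_velocity (fun s => g s *m h s) t (V *m h t + g t *m W).
Proof.
move=> hg hh i j.
have -> : (V *m h t + g t *m W) i j =
    \sum_k (V i k * h t k j + g t i k * W k j) by rewrite !mxE big_split.
apply: (@cderiv_ext (fun s => \sum_k g s i k * h s k j)).
  by move=> s; rewrite mxE.
by apply: cderiv_sum => k; exact: cderivM (hg i k) (hh k j).
Qed.

Lemma cderiv_tr g t V : has_velocity g t V ->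
  cderiv (fun s => \tr (g s)) t (\tr V).
Proof. by move=> hg; apply: cderiv_sum => i; apply: hg. Qed.

Lemma is_derive_kappa g t V N : has_velocity g t V ->
  is_derive t (1 : R) (fun s => kappa (g s) N) (kappa V N).
Proof.
move=> hg; have := cderiv_tr (has_velocityM hg (has_velocity_cst N t)).
by rewrite mulmx0 addr0 => -[].
Qed.

(** Bracketing with B is a derivation of the matrix product, so every power of a
solution of a Lax equation solves the same Lax equation. *)
Lemma has_velocity_exp_bracket g t B k :
  has_velocity g t (lie (g t) B) ->
  has_velocity (fun s => g s ^+ k) t (lie (g t ^+ k) B).
Proof.
move=> hg; elim: k => [|k IH].
  by rewrite /lie expr0 mul1mx mulmx1 subrr; exact: has_velocity_cst.
have := has_velocityM hg IH.
rewrite (_ : _ + _ = lie (g t ^+ k.+1) B).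
  rewrite (_ : (fun s => _ *m _) = fun s => g s ^+ k.+1) //.
  by apply/funext => s; rewrite exprS.
rewrite /lie mulmxBl mulmxBr !mulmxA exprS.
by rewrite addrC addrA subrK !mulmxA.
Qed.

(** The isospectral property in differential form: a commutator is traceless. *)
Lemma lax_trace_exp g t B k : has_velocity g t (lie (g t) B) ->
  cderiv (fun s => \tr (g s ^+ k)) t 0.
Proof.
move=> /(has_velocity_exp_bracket k) /cderiv_tr.
by rewrite /lie raddfB /= mxtrace_mulC subrr.
Qed.

End Matrix.

Lemma is_derive0_cst_on_interval (I : set R) (f : R -> R) : is_interval I ->
  (forall t, I t -> is_derive t (1 : R) f 0) -> forall s t, I s -> I t -> f s = f t.
Proof.
move=> hI hf; suff le s t : I s -> I t -> s <= t -> f s = f t.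
  by move=> s t hs ht; case: (leP s t) => [|/ltW] /le e; [exact: e|apply/esym/e].
move=> hs ht st.
have sub x : x \in `[s, t] -> I x by rewrite in_itv /= => /hI; apply.
have [||c _] := @MVT_segment R f (fun=> 0) s t st.
- by move=> x /subset_itv_oo_cc /sub /hf.
- by apply: derivable_within_continuous => x /sub /hf [].
- by rewrite mul0r => /eqP; rewrite subr_eq0 => /eqP.
Qed.

Lemma cderiv0_cst_on_interval (I : set R) (f : R -> R[i]) : is_interval I ->
  (forall t, I t -> cderiv f t 0) -> forall s t, I s -> I t -> f s = f t.
Proof.
move=> hI hf s t hs ht.
have eR := is_derive0_cst_on_interval hI (fun x hx => (hf x hx).1) hs ht.
have eI := is_derive0_cst_on_interval hI (fun x hx => (hf x hx).2) hs ht.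
by move: eR eI => /=; case: (f s) (f t) => a b [c d] /= -> ->.
Qed.

End Velocity.

(** * Power sums determine a multiset *)

Section PowerSums.
Variable F : numFieldType.
Implicit Types s : seq F.

Lemma eq_power_sums_horner s1 s2 :
  (forall k, \sum_(x <- s1) x ^+ k = \sum_(x <- s2) x ^+ k) ->
  forall p : {poly F}, \sum_(x <- s1) p.[x] = \sum_(x <- s2) p.[x].
Proof.
move=> h p; under eq_bigr do rewrite horner_coef.
under [RHS]eq_bigr do rewrite horner_coef.
rewrite exchange_big [RHS]exchange_big /=; apply: eq_bigr => k _.
by rewrite -!mulr_sumr h.
Qed.

(** To compare the multiplicities of z, sum over both lists a polynomial that
vanishes at every listed value except z.  The sum is a fixed nonzero number
times the multiplicity of z, and characteristic zero recovers the latter. *)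
Lemma eq_power_sums_perm s1 s2 :
  (forall k, \sum_(x <- s1) x ^+ k = \sum_(x <- s2) x ^+ k) ->
  perm_eq s1 s2.
Proof.
move=> /eq_power_sums_horner h; apply/allP => z _ /=.
pose p := \prod_(y <- s1 ++ s2 | y != z) ('X - y%:P).
have pz : p.[z] != 0.
  rewrite horner_prod prodf_seq_neq0; apply/allP => y _; apply/implyP => yz.
  by rewrite hornerXsubC subr_eq0 eq_sym.
have sump s : {subset s <= s1 ++ s2} ->
    \sum_(x <- s) p.[x] = p.[z] *+ count_mem z s.
  move=> sub; rewrite -sum1_count -sumrMnr [RHS]big_mkcond [LHS]big_seq [RHS]big_seq.
  apply: eq_bigr => x /sub xs /=; have [->//|xz] := eqVneq x z.
  apply/eqP; rewrite horner_prod prodf_seq_eq0.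
  by apply/hasP; exists x; rewrite //= xz hornerXsubC subrr eqxx.
have := h p; rewrite !sump; try by move=> x xs; rewrite mem_cat xs ?orbT.
by move/(mulrIn pz) => ->.
Qed.

End PowerSums.

(** * The adjoint orbit, its tangent curves and Lax flows *)

Section Orbit.
Variables (R : realType) (n : nat).
Implicit Types A B L X P : 'M[R[i]]_n.

Lemma adjoint_orbit_conj L A P : P \is unitarymx -> adjoint_orbit L A ->
  adjoint_orbit L (P *m A *m P ^t*).
Proof.
move=> uP [T uT <-]; have uPT := mul_unitarymx uP uT.
exists (P *m T) => //.
by rewrite (invmx_unitary uPT) (invmx_unitary uT) adjmxM !mulmxA.
Qed.

Lemma perm_mx_unitary (s : 'S_n) : perm_mx s \is @unitarymx R[i] n n.
Proof.
by apply/unitarymxP; rewrite tr_perm_mx map_perm_mx -perm_mxM mulgV perm_mx1.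
Qed.

Lemma diag_mx_perm (s : 'S_n) (d : 'rV[R[i]]_n) :
  diag_mx (\row_i d 0 (s i)) = perm_mx s *m diag_mx d *m (perm_mx s) ^t*.
Proof.
rewrite tr_perm_mx map_perm_mx -row_permE -col_permE.
by apply/matrixP => i j; rewrite !mxE (inj_eq perm_inj).
Qed.

Lemma mxtrace_exp_spectral P (d : 'rV[R[i]]_n) k : P \is unitarymx ->
  \tr ((P ^t* *m diag_mx d *m P) ^+ k) = \sum_i d 0 i ^+ k.
Proof.
move=> uP.
have -> : (P ^t* *m diag_mx d *m P) ^+ k = P ^t* *m diag_mx (\row_i d 0 i ^+ k) *m P.
  elim: k => [|k IH].
    rewrite expr0 (_ : diag_mx _ = 1%:M).
      by rewrite mulmx1 -invmx_unitary // mulVmx // unitarymx_unit.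
    by apply/matrixP => i j; rewrite !mxE.
  rewrite exprS IH -mulmxE !mulmxA (mulmxtVK _ uP) -(mulmxA (P ^t*)) mulmx_diag.
  by congr (_ *m diag_mx _ *m _); apply/rowP => i; rewrite !mxE exprS.
rewrite mxtrace_mulC mulmxA (unitarymxP uP) mul1mx mxtrace_diag.
by apply: eq_bigr => i _; rewrite mxE.
Qed.

(** Tr(A^k) is the k-th power sum of the eigenvalues, so the spectra of A and B
agree up to a permutation of the eigenvectors, and a permutation matrix is
unitary. *)
Lemma isospectral_adjoint_orbit A B : lie_un A -> lie_un B ->
  (forall k, \tr (A ^+ k) = \tr (B ^+ k)) -> adjoint_orbit A B.
Proof.
move=> /skew_spectral [P [a [uP -> _]]] /skew_spectral [Q [b [uQ -> _]]] h.
have [s es] : exists s : 'S_n, b = \row_i a 0 (s i).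
  have : perm_eq [tuple b 0 i | i < n] [tuple a 0 i | i < n].
    apply: eq_power_sums_perm => k.
    have sumT (d : 'rV[R[i]]_n) :
        \sum_(x <- [tuple d 0 i | i < n]) x ^+ k = \sum_i d 0 i ^+ k.
      by rewrite big_tuple; apply: eq_bigr => i _; rewrite tnth_mktuple.
    rewrite !sumT -(mxtrace_exp_spectral b k uQ) -(mxtrace_exp_spectral a k uP).
    exact/esym/h.
  case/tuple_permP => s /val_inj e; exists s.
  apply/rowP => i; rewrite mxE; have := congr1 (fun u => tnth u i) e.
  by rewrite !tnth_mktuple.
pose T := Q ^t* *m perm_mx s *m P.
have uT : T \is unitarymx.
  have uQ' : Q ^t* \is unitarymx by rewrite trmxC_unitary.
  exact: mul_unitarymx (mul_unitarymx uQ' (perm_mx_unitary s)) uP.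
exists T; first exact: uT.
rewrite (invmx_unitary uT) es diag_mx_perm /T !adjmxM trmxCK !mulmxA.
by rewrite !(mulmxtVK _ uP).
Qed.

Lemma has_velocity_adjmx (g : R -> 'M[R[i]]_n) t V : has_velocity g t V ->
  has_velocity (fun s => (g s) ^t*) t (V ^t*).
Proof.
move=> hg i j; have [hR hI] := hg j i; rewrite !mxE; split.
  rewrite (_ : (fun s => _) = (fun s => complex.Re (g s j i))).
    by case: (V j i) hR.
  by apply/funext => s; rewrite !mxE; case: (g s j i).
have := is_deriveN hI; set G := (X in is_derive _ _ X _) => H.
rewrite (_ : (fun s => _) = G); first by case: (V j i) H.
by apply/funext => s; rewrite !mxE /G fctE; case: (g s j i).
Qed.

(** The derivative at 0 of the unit complex number e^(isy). *)
Lemma cderiv_phase (y : R) :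
  cderiv (fun s => Complex (cos (s * y)) (sin (s * y))) 0 (Complex 0 y).
Proof.
have hm : is_derive (0 : R) (1 : R) (fun s : R => s * y) y.
  have := is_deriveM (is_derive_id (0 : R) (1 : R)) (is_derive_cst y (0 : R) (1 : R)).
  set G := (X in is_derive _ _ X _) => H.
  rewrite (_ : (fun s => _) = G) //.
  by apply: is_derive_eq H _; rewrite /GRing.scale /=; ring.
split => /=.
  have := @is_derive1_comp R cos (fun s => s * y) 0 _ _ (is_derive_cos (0 * y)) hm.
  by rewrite mul0r sin0 oppr0 mul0r.
have := @is_derive1_comp R sin (fun s => s * y) 0 _ _ (is_derive_sin (0 * y)) hm.
by rewrite mul0r cos0 mul1r.
Qed.

(** The curve is s |-> exp(sX).  Diagonalizing X reduces the matrix exponential to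
the phases e^(isy), where the iy are the eigenvalues of X. *)
Lemma unitary_curve X : lie_un X -> exists T : R -> 'M[R[i]]_n,
  [/\ T 0 = 1%:M, forall s, T s \is unitarymx & has_velocity T 0 X].
Proof.
move=> /skew_spectral [P [d [uP eX hd]]].
pose y i := complex.Im (d 0 i).
have ed i : d 0 i = Complex 0 (y i).
  move: (hd i); rewrite /y; case: (d 0 i) => a b /= [/eqP].
  by rewrite -addr_eq0 -mulr2n mulrn_eq0 /= => /eqP ->.
pose E s := diag_mx (\row_i Complex (cos (s * y i)) (sin (s * y i))).
have hE : has_velocity E 0 (diag_mx d).
  move=> i j; have [eij|nij] := eqVneq i j.
    rewrite !mxE eij eqxx mulr1n ed.
    apply: (cderiv_ext _ (cderiv_phase (y j))) => s.
    by rewrite !mxE eqxx mulr1n.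
  rewrite !mxE (negPf nij) mulr0n.
  apply: (cderiv_ext _ (cderiv_cst 0 0)) => s.
  by rewrite !mxE (negPf nij) mulr0n.
have uE s : E s \is unitarymx.
  apply/unitarymxP; rewrite tr_diag_mx map_diag_mx mulmx_diag.
  apply/matrixP => i j; rewrite !mxE; congr (_ *+ _).
  by congr Complex; rewrite /= ?mulrN ?opprK -?expr2 ?cos2Dsin2 //; ring.
exists (fun s => P ^t* *m E s *m P); split.
- rewrite (_ : E 0 = 1%:M).
    by rewrite mulmx1 -invmx_unitary // mulVmx // unitarymx_unit.
  by apply/matrixP => i j; rewrite !mxE mul0r cos0 sin0.
- move=> s; have uP' : P ^t* \is unitarymx by rewrite trmxC_unitary.
  exact: mul_unitarymx (mul_unitarymx uP' (uE s)) uP.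
- have := has_velocityM (has_velocityM (has_velocity_cst (P ^t*) 0) hE)
    (has_velocity_cst P 0).
  by rewrite mul0mx add0r mulmx0 addr0 -eX.
Qed.

(** For T(s) = exp(sX), the curve T(s)^H L T(s) stays on the orbit and has velocity
X^H L + L X = L X - X L at 0. *)
Lemma curve_through_orbit L0 L X : adjoint_orbit L0 L -> lie_un X ->
  exists g, curve_through (adjoint_orbit L0) L (lie L X) g.
Proof.
move=> hL hX; have [T [T0 uT vT]] := unitary_curve hX.
exists (fun s => (T s) ^t* *m L *m T s); split.
- by rewrite T0 trmx1 map_mx1 mul1mx mulmx1.
- near=> s.
  have uT' : (T s) ^t* \is unitarymx by rewrite trmxC_unitary.
  by have := adjoint_orbit_conj uT' hL; rewrite trmxCK.
have := has_velocityM (has_velocityM (has_velocity_adjmx vT) (has_velocity_cst L 0)) vT.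
by rewrite T0 trmx1 map_mx1 mulmx0 addr0 mulmx1 mul1mx hX mulNmx addrC.
Unshelve. all: by end_near.
Qed.

Lemma kappa_differential N L0 L X : adjoint_orbit L0 L -> lie_un X ->
  is_differential (adjoint_orbit L0) (fun M => kappa M N) L (lie L X)
    (kappa (lie L X) N).
Proof.
move=> hL hX; split; first exact: curve_through_orbit.
by move=> g [_ _ vg]; exact: is_derive_kappa.
Qed.

(** Uniqueness relies on the existence of at least one curve, which is part of
[is_differential]. *)
Lemma is_differential_unique (O : set 'M[R[i]]_n) H L V a b :
  is_differential O H L V a -> is_differential O H L V b -> a = b.
Proof.
move=> [[g hg] ha] [_ hb].
by have /@derive_val <- := ha g hg; have /@derive_val <- := hb g hg.
Qed.

Lemma gradient_kappa N L0 L G : lie_un N -> lie_un L0 -> adjoint_orbit L0 L ->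
  is_gradient (adjoint_orbit L0) (fun M => kappa M N) L G <->
  G = lie L (lie L N).
Proof.
move=> hN hL0 hL; have uL := adjoint_orbit_lie_un hL0 hL.
have uLN : lie_un (lie L N) by exact: lie_un_lie.
split=> [[[Y hY <-] hG]|->].
  apply: (normal_metric_nondegenerate uL hY uLN) => Z hZ.
  rewrite (normal_metric_double_bracket uL hN hZ).
  exact: is_differential_unique (hG Z hZ) (kappa_differential N hL hZ).
split; first by exists (lie L N).
move=> X hX; rewrite (normal_metric_double_bracket uL hN hX).
exact: kappa_differential.
Qed.

(** The traces of the powers are constant along a Lax equation, so the values at
two times are isospectral, hence conjugate.  The matrix B may depend on the
solution, as it does for the double bracket flow. *)
Lemma lax_flow_adjoint_orbit (I : set R) (g B : R -> 'M[R[i]]_n) :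
  is_interval I ->
  (forall t, I t -> lie_un (g t) /\ has_velocity g t (lie (g t) (B t))) ->
  forall s t, I s -> I t -> adjoint_orbit (g s) (g t).
Proof.
move=> hI hg s t hs ht; apply: isospectral_adjoint_orbit => [||k].
- exact: (hg s hs).1.
- exact: (hg t ht).1.
- have tr0 x : I x -> cderiv (fun x => \tr (g x ^+ k)) x 0.
    by move=> hx; exact: lax_trace_exp (hg x hx).2.
  exact: cderiv0_cst_on_interval hI tr0 _ _ hs ht.
Qed.

End Orbit.

(** * The double bracket flow *)

Theorem theorem2p2 (R : realType) (n : nat) (N L0 : 'M[R[i]]_n)
    (hN : lie_un N) (hL0 : lie_un L0) :
  (forall L G : 'M[R[i]]_n, adjoint_orbit L0 L ->
     (is_gradient (adjoint_orbit L0) (fun M => kappa M N) L G <->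
      G = lie L (lie L N)))
  /\
  (forall (I : set R) (g : R -> 'M[R[i]]_n),
     open I -> is_interval I -> I 0 -> g 0 = L0 ->
     ((forall t, I t ->
         lie_un (g t) /\ has_velocity g t (lie (g t) (lie (g t) N)))
      <->
      (forall t, I t ->
         adjoint_orbit L0 (g t) /\
         exists2 G, is_gradient (adjoint_orbit L0) (fun M => kappa M N) (g t) G
                  & has_velocity g t G))).
Proof.
split=> [L G hL|I g oI iI I0 g0]; first exact: gradient_kappa.
split=> hg t It.
  have Ot : adjoint_orbit L0 (g t).
    by rewrite -g0; exact: (lax_flow_adjoint_orbit iI hg I0 It).
  split=> //; exists (lie (g t) (lie (g t) N)); last exact: (hg t It).2.
  exact/gradient_kappa.
have [Ot [G hG vG]] := hg t It; split; first exact: adjoint_orbit_lie_un Ot.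
by move: hG vG => /(gradient_kappa _ hN hL0 Ot) ->.
Qed.
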